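(* Let $n\ge1$, let $f:\{0,1\}^n\to\{0,1\}$ be a Boolean function, and let $V_f$ be the corresponding quantum phase-oracle. If $V_f$ is separability-conserving, then $f\in F_{DJ}^{\otimes}$, i.e. there exist $a\in\{0,1\}^n$ and $c\in\{0,1\}$ such that $f(x)=(a\cdot x)\oplus c$ for all $x\in\{0,1\}^n$.
   Context: For $a,x\in\{0,1\}^n$, $a\cdot x=\sum_i a_ix_i \bmod 2$, and $\oplus$ is addition modulo 2. $F_{DJ}^{\otimes}$ is the set of all Boolean functions $f:\{0,1\}^n\to\{0,1\}$ of the form $f(x)=(a\cdot x)\oplus c$ with $a\in\{0,1\}^n$, $c\in\{0,1\}$. The quantum phase-oracle of $f$ is the unitary operator $V_f$ on $n$ qubits defined by $V_f|x\rangle=(-1)^{f(x)}|x\rangle$ for $x\in\{0,1\}^n$. A pure state of $n$ qubits (unit vector in $(\mathbb{C}^2)^{\otimes n}$) is separable if it is a tensor product of $n$ single-qubit states. An operation $U$ is separability-conserving if $U|\psi\rangle$ is separable for every separable state $|\psi\rangle$. *)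

(* Defs.v *)
From HB Require Import structures.
From mathcomp Require Import all_boot all_order all_algebra.
Set Implicit Arguments.
Unset Strict Implicit.
Unset Printing Implicit Defensive.
Import Order.TTheory GRing.Theory Num.Theory.
Local Open Scope ring_scope.

Definition bits (n : nat) : finType := {ffun 'I_n -> bool}.

Definition bdot n (a x : bits n) : bool := odd (\sum_(i < n) a i * x i)%N.

Definition FDJ n (f : bits n -> bool) : Prop :=
  exists (a : bits n) (c : bool), forall x, f x = bdot a x (+) c.

(* [C] plays the role of the complex numbers, [R[i]] for [R : realType].
   [hilb C I] is the Hilbert space with orthonormal basis [ket i], [i : I].  The
   qubit C^2 is [hilb C bool]; the n-fold tensor power (C^2)^{\otimes n} is
   [hilb C (bits n)], a vector being given by its 2^n amplitudes.  The regular
   module [C^o] is needed for the vector space structure over [C]. *)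
Definition hilb (C : numClosedFieldType) (I : finType) : vectType C :=
  {ffun I -> C^o}.

Definition ket (C : numClosedFieldType) (I : finType) (i : I) : hilb C I :=
  [ffun j => (j == i)%:R].

Definition inner (C : numClosedFieldType) (I : finType) (u v : hilb C I) : C :=
  \sum_i Num.conj (u i : C) * (v i : C).

Definition unit_vector (C : numClosedFieldType) (I : finType) (u : hilb C I) : Prop :=
  inner u u = 1.

Definition unitary (C : numClosedFieldType) (I : finType) (U : 'End(hilb C I)) : Prop :=
  lker U = 0%VS /\ forall u v, inner (U u) (U v) = inner u v.

(* phi_0 \otimes ... \otimes phi_(n-1), where
   |x_0> \otimes ... \otimes |x_(n-1)> is identified with |x_0...x_(n-1)>. *)
Definition tensor (C : numClosedFieldType) n (phi : 'I_n -> hilb C bool) :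
    hilb C (bits n) :=
  [ffun x : bits n => \prod_(i < n) (phi i (x i) : C)].

Definition separable (C : numClosedFieldType) n (psi : hilb C (bits n)) : Prop :=
  unit_vector psi /\
  exists phi : 'I_n -> hilb C bool,
    (forall i, unit_vector (phi i)) /\ psi = tensor phi.

Definition separability_conserving (C : numClosedFieldType) n
    (U : 'End(hilb C (bits n))) : Prop :=
  forall psi, separable psi -> separable (U psi).

(* Linear extension of |x> |-> (-1)^{f(x)} |x>; see [phase_oracle_ket]. *)
Definition phase_fun (C : numClosedFieldType) n (f : bits n -> bool)
    (psi : hilb C (bits n)) : hilb C (bits n) :=
  \sum_x (psi x : C) *: ((-1) ^+ f x *: ket C x).

Lemma phase_fun_is_linear (C : numClosedFieldType) n (f : bits n -> bool) :
  linear (@phase_fun C n f).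
Proof.
move=> k u v; rewrite /phase_fun scaler_sumr -big_split /=.
apply: eq_bigr => y _; rewrite !ffunE scalerDl.
by rewrite (scalerA k (u y : C)).
Qed.

HB.instance Definition _ (C : numClosedFieldType) n (f : bits n -> bool) :=
  GRing.isLinear.Build C (hilb C (bits n)) (hilb C (bits n)) *:%R
    (@phase_fun C n f) (@phase_fun_is_linear C n f).

Definition phase_oracle (C : numClosedFieldType) n (f : bits n -> bool) :
    'End(hilb C (bits n)) :=
  linfun (@phase_fun C n f).

Lemma phase_oracleE (C : numClosedFieldType) n (f : bits n -> bool)
    (psi : hilb C (bits n)) (x : bits n) :
  phase_oracle C f psi x = (-1) ^+ f x * psi x :> C.
Proof.
have ketE y (k l : C) :
    (k *: (l *: ket C y)) x = k * (l * (x == y)%:R) :> C.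
  by rewrite !ffunE.
rewrite lfunE /= /phase_fun sum_ffunE (bigD1 x) //= ketE eqxx mulr1 mulrC.
rewrite big1 ?addr0 // => y; rewrite eq_sym => /negbTE yx.
by rewrite ketE yx !mulr0.
Qed.

Lemma phase_oracle_ket (C : numClosedFieldType) n (f : bits n -> bool) (x : bits n) :
  phase_oracle C f (ket C x) = (-1) ^+ f x *: ket C x.
Proof.
apply/ffunP => y; rewrite phase_oracleE !ffunE.
by case: eqP => [->//|_]; rewrite mulr0 scaler0.
Qed.

Lemma phase_oracle_unitary (C : numClosedFieldType) n (f : bits n -> bool) :
  unitary (phase_oracle C f).
Proof.
split=> [|u v].
  apply/eqP/lker0P => u v uv; apply/ffunP => x.
  have := congr1 (fun w : hilb C (bits n) => (-1) ^+ f x * (w x : C)) uv.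
  by rewrite /= !phase_oracleE !signrMK.
apply: eq_bigr => x _; rewrite !phase_oracleE rmorphM rmorph_sign mulrACA.
by rewrite -signr_addb addbb mul1r.
Qed.

(* Main.v *)
(* Apply V_f to the uniform superposition, a product state all of whose
   amplitudes equal s^n with s <> 0.  If the image is again a product state,
   then (-1)^(f x) s^n = \prod_i phi_i(x_i), so no phi_i vanishes, and comparing
   the values at 0 and at e_i gives phi_i(1) = (-1)^(a_i) phi_i(0) with
   a_i = f(e_i) (+) f(0).  Hence (-1)^(f x) = (-1)^(a . x) (-1)^(f 0). *)
Require Import Defs.
From mathcomp Require Import all_boot all_order all_algebra.
From mathcomp Require Import complex reals.

Set Implicit Arguments.
Unset Strict Implicit.
Unset Printing Implicit Defensive.
Import GRing.Theory Num.Theory.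

Local Open Scope complex_scope.
Local Open Scope ring_scope.

(** Distributivity: a product of sums over one bit expands into a sum over bit strings. *)
Lemma inner_tensor (C : numClosedFieldType) n (phi psi : 'I_n -> hilb C bool) :
  inner (tensor phi) (tensor psi) = \prod_(i < n) inner (phi i) (psi i).
Proof.
rewrite /inner bigA_distr_bigA /=; apply: eq_bigr => x _.
by rewrite !ffunE rmorph_prod -big_split.
Qed.

Lemma separable_tensor (C : numClosedFieldType) n (phi : 'I_n -> hilb C bool) :
  (forall i, unit_vector (phi i)) -> separable (tensor phi).
Proof.
move=> phi1; split; last by exists phi.
by rewrite /unit_vector inner_tensor big1 // => i _; exact: phi1.
Qed.

Definition plus_amp (C : numClosedFieldType) : C := sqrtC 2^-1.

Definition plus_state (C : numClosedFieldType) : hilb C bool :=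
  [ffun=> plus_amp C].

Lemma unit_vector_plus_state (C : numClosedFieldType) :
  unit_vector (plus_state C).
Proof.
rewrite /unit_vector /inner big_bool /= !ffunE.
(* The square root of a nonnegative number is real, hence fixed by conjugation. *)
have sR : Num.conj (plus_amp C) = plus_amp C.
  by apply/CrealP/ger0_real; rewrite sqrtC_ge0 invr_ge0 ler0n.
by rewrite sR -expr2 sqrtCK -mulr2n -[LHS]mulr_natl divff // pnatr_eq0.
Qed.

Definition basis_bits n (i : 'I_n) : bits n := [ffun j => j == i].

(** A sign depends only on the parity of its exponent, so the sum inside [bdot] turns into a product
    of signs. *)
Lemma signr_bdot (K : pzRingType) n (a x : bits n) :
  (-1) ^+ bdot a x = \prod_(i < n) (-1) ^+ (a i && x i) :> K.
Proof.
rewrite signr_odd; elim/big_rec2: _ => // i p m _ <-.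
by rewrite exprD mulnb.
Qed.

(** The algebraic core, free of quantum states: [k] stands for the common amplitude of the uniform
    superposition. *)
Lemma FDJ_of_product_phase (K : numDomainType) n (f : bits n -> bool) (k : K)
    (phi : 'I_n -> bool -> K) :
    k != 0 -> (forall x : bits n, (-1) ^+ f x * k = \prod_(i < n) phi i (x i)) ->
  FDJ f.
Proof.
move=> k0 prodE; pose z : bits n := [ffun=> false].
have prodz : \prod_(i < n) phi i false = (-1) ^+ f z * k.
  by rewrite prodE; apply: eq_bigr => i _; rewrite ffunE.
pose a : bits n := [ffun i => f (basis_bits i) (+) f z].
have phiE i b : phi i b = (-1) ^+ (a i && b) * phi i false.
  case: b; last by rewrite andbF mul1r.
  (* Cancelling the other factors at 0 isolates [phi i]; their product divides the nonzero value
     [prodz]. *)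
  have q0 : \prod_(j < n | j != i) phi j false != 0.
    have : \prod_(j < n) phi j false != 0.
      by rewrite prodz mulf_neq0 ?signr_eq0.
    by rewrite (bigD1 i) //= mulf_eq0 => /norP[].
  apply: (mulIf q0); rewrite andbT -mulrA.
  have -> : phi i false * \prod_(j < n | j != i) phi j false = (-1) ^+ f z * k.
    by rewrite -prodz [RHS](bigD1 i).
  (* At e_i every factor except the i-th keeps its value at 0. *)
  have := prodE (basis_bits i); rewrite (bigD1 i) //= ffunE eqxx.
  under eq_bigr => j /negbTE ji do rewrite ffunE ji.
  by move=> <-; rewrite mulrA -signr_addb ffunE addbK.
(* Since 1 and -1 differ in [K], it suffices to compare signs, scaled by [k]. *)
exists a, (f z) => x; apply: (@signr_inj K); apply: (mulIf k0).
rewrite prodE; under eq_bigr => i _ do rewrite phiE.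
by rewrite big_split /= -signr_bdot prodz mulrA -signr_addb.
Qed.

Theorem proposition2p7 (R : realType) (n : nat) (n_ge1 : (1 <= n)%N)
    (f : bits n -> bool) :
  separability_conserving (phase_oracle R[i] f) -> FDJ f.
Proof.
pose C : numClosedFieldType := R[i].
have sep := @separable_tensor C n _ (fun=> unit_vector_plus_state C).
move=> /(_ _ sep)[_ [phi [_ Ephi]]].
apply: (@FDJ_of_product_phase C n f (\prod_(i < n) plus_amp C) phi).
  by rewrite prodf_seq_neq0; apply/allP => i _; rewrite sqrtC_eq0 invr_eq0 pnatr_eq0.
move=> x; have := congr1 (fun u : hilb C (bits n) => u x : C) Ephi.
rewrite phase_oracleE !ffunE => <-; congr (_ * _).
by apply: eq_bigr => i _; rewrite ffunE.
Qed.
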